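(* Let $H$ be a complex Hilbert space, let $A\in B(H)$, let $0\leq\lambda\leq 1$ and put $r=\min\{\lambda,1-\lambda\}$. Then $$w(A)\leq \frac{1-2r}{2}\,\big\|\,|A|+|A^{*}|\,\big\|+2r\|A\|.$$
   Context: $B(H)$ denotes the algebra of all bounded linear operators on the complex Hilbert space $H$, and $\|\cdot\|$ is the operator norm. The numerical radius of $A\in B(H)$ is $w(A)=\sup\{|\langle Ax,x\rangle| : x\in H,\ \|x\|=1\}$. For $T\in B(H)$, $|T|=(T^*T)^{1/2}$. *)

(* Defs.v *)
From HB Require Import structures.
From mathcomp Require Import all_boot all_order all_algebra.
From mathcomp Require Import all_classical all_reals all_analysis.
From mathcomp Require Import complex.

Set Implicit Arguments.
Unset Strict Implicit.
Unset Printing Implicit Defensive.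

Import Order.TTheory GRing.Theory Num.Theory.
Import numFieldNormedType.Exports.

Local Open Scope classical_set_scope.
Local Open Scope ring_scope.
Local Open Scope complex_scope.

(* The axioms on [dotp], linear in its first argument, say that it is an inner
   product inducing the norm; completeness is inherited. *)
HB.mixin Record CompleteNormedModule_isHilbert (R : realType) (H : Type)
    of CompleteNormedModule R[i] H := {
  dotp : H -> H -> R[i] ;
  dotp_linearl : forall y : H, linear_for *%R (dotp^~ y) ;
  dotp_conjC : forall x y : H, dotp x y = Num.conj (dotp y x) ;
  dotp_normE : forall x : H, dotp x x = `|x| ^+ 2
}.

#[short(type="hilbertType")]
HB.structure Definition Hilbert (R : realType) :=
  {H of CompleteNormedModule R[i] H & CompleteNormedModule_isHilbert R H}.

Section dot_instance.
Context {R : realType} {H : hilbertType R}.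

Let dotp_bilinear :
  bilinear_for *%R (@Num.conj R[i] \; *%R) (@dotp R H).
Proof.
split=> [y|x a u v]; first exact: dotp_linearl.
by rewrite dotp_conjC dotp_linearl rmorphD rmorphM /= -!dotp_conjC.
Qed.

HB.instance Definition _ :=
  bilinear_isBilinear.Build R[i] H H R[i] *%R (@Num.conj R[i] \; *%R)
    (@dotp R H) dotp_bilinear.

Let dotp_hermitian x y :
  @dotp R H x y = (-1) ^+ false * Num.conj (@dotp R H y x).
Proof. by rewrite expr0 mul1r -dotp_conjC. Qed.

HB.instance Definition _ :=
  isHermitianSesquilinear.Build R[i] H false (@Num.conj R[i]) (@dotp R H)
    dotp_hermitian.

Let dotp_gt0 (x : H) : x != 0 -> 0 < dotp x x.
Proof. by move=> x0; rewrite dotp_normE exprn_gt0// normr_gt0. Qed.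

HB.instance Definition _ := isDotProduct.Build R[i] H (@dotp R H) dotp_gt0.

End dot_instance.

Notation "'[ u , v ]" := (dotp u v) : ring_scope.

Section bounded_operators.
Context {R : realType} {H : hilbertType R}.
Implicit Types T S : H -> H.

Definition bounded_op : set (H -> H) :=
  [set T | linear T /\ exists M : R, forall x, `|T x| <= M%:C * `|x|].

(* Norms in [H] and in [R[i]] take values in [R[i]], hence the real parts. *)
Definition opnorm T : R :=
  sup [set complex.Re `|T x| | x in [set x : H | `|x| <= 1]].

(* On the zero space the supremum is over the empty set, and [sup set0 = 0]. *)
Definition numerical_radius T : R :=
  sup [set complex.Re `|'[T x, x]| | x in [set x : H | `|x| = 1]].

Definition is_adjoint T S := forall x y : H, '[T x, y] = '[x, S y].

(* The adjoint exists and is unique for [T] in [bounded_op] (Riesz). *)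
Definition adjoint T : H -> H := xget 0 [set S | bounded_op S /\ is_adjoint T S].

Definition positive_op T := forall x : H, 0 <= '[T x, x].

(* The positive square root exists and is unique when [T] is in [bounded_op]
   and positive. *)
Definition sqrt_op T : H -> H :=
  xget 0 [set S | [/\ bounded_op S, positive_op S & S \o S = T]].

Definition abs_op T : H -> H := sqrt_op (adjoint T \o T).

End bounded_operators.

(* Main.v *)
Require Import Defs.
From HB Require Import structures.
From mathcomp Require Import all_boot all_order all_algebra.
From mathcomp Require Import all_classical all_reals all_analysis.
From mathcomp Require Import complex ring lra.
Import Order.TTheory GRing.Theory Num.Theory.
Import numFieldNormedType.Exports.
Local Open Scope classical_set_scope.
Local Open Scope ring_scope.

(** The bound is a convex combination, with weights [1 - 2r] and [2r], of
    [w(A) <= || |A| + |A*| || / 2] and [w(A) <= ||A||].  The second is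
    Cauchy-Schwarz.  The first comes from the mixed Schwarz inequality
    [2 Re <Ax,y> <= <|A|x,x> + <|A*|y,y>] ([mixed_schwarz]), applied after
    rotating [x] so that [<Ax,x>] becomes real and nonnegative.

    Mixed Schwarz rests on two facts: [|A|] and [A] have the same norm at every
    vector, and [A |A| = |A*| A].  If [x = |A| z], the difference of the two
    sides is [<|A*|(Az - y), Az - y> >= 0]; a general [x] is the sum of a limit
    of such vectors and of a vector of [ker |A| = ker A].

    The intertwining relation needs a concrete square root.  For [0 <= T <= c],
    put [X = 1 - T / c]; the iteration [Y_0 = 0], [Y_(n+1) = (X + Y_n^2) / 2]
    converges in operator norm, because its increments are dominated by those
    of the same scalar iteration at [X = 1], and [sqrt c (1 - lim Y_n)] is a
    square root of [T] ([psd_sqrt]).  The [Y_n] are polynomials in [X], so the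
    limit commutes with every bounded operator that commutes with [T]; this gives
    uniqueness of the positive square root; and [A (A* A) = (A A* ) A] passes to
    the square roots ([approximated_intertwine]).

    Adjoints and the decomposition of [x] above both come from one minimization
    argument ([riesz_on]).  Nearly everything takes place in the real inner
    product space underlying [H], with real-valued norms, and with sequences
    that converge at an explicit rate [k / (n + 1)]. *)

(** * The underlying real inner product space *)

Section real_structure.
Set Implicit Arguments.
Unset Strict Implicit.
Unset Printing Implicit Defensive.
Local Open Scope complex_scope.
Context {R : realType} {H : hilbertType R}.
Implicit Types (x y z : H) (t : R).

Definition rdot x y : R := complex.Re (dotp x y).

Definition hnorm x : R := complex.Re `|x|.

Lemma normE x : `|x| = (hnorm x)%:C.
Proof. by rewrite /hnorm RRe_real// ger0_real. Qed.

Lemma hnorm_ge0 x : 0 <= hnorm x.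
Proof. by rewrite -lecR -normE; exact: normr_ge0. Qed.

Lemma hnorm0 : hnorm 0 = 0.
Proof. by rewrite /hnorm normr0. Qed.

Lemma hnormD x y : hnorm (x + y) <= hnorm x + hnorm y.
Proof. by rewrite -lecR rmorphD/= -!normE ler_normD. Qed.

Lemma hnormN x : hnorm (- x) = hnorm x.
Proof. by rewrite /hnorm normrN. Qed.

Lemma hdistC x y : hnorm (x - y) = hnorm (y - x).
Proof. by rewrite -hnormN opprB. Qed.

Lemma hnormZ (a : R[i]) x : hnorm (a *: x) = complex.Re `|a| * hnorm x.
Proof. by rewrite {1}/hnorm normrZ (normE x) normc_def /= mulr0 subr0. Qed.

Lemma hnormZr t x : hnorm (t%:C *: x) = `|t| * hnorm x.
Proof. by rewrite hnormZ normc_def /= expr0n addr0 sqrtr_sqr. Qed.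

Lemma rdotC x y : rdot x y = rdot y x.
Proof. by rewrite /rdot dotp_conjC; case: (dotp y x). Qed.

Lemma rdotDl x y z : rdot (x + y) z = rdot x z + rdot y z.
Proof.
rewrite /rdot -[x]scale1r dotp_linearl mul1r scale1r.
by case: (dotp x z) => ? ?; case: (dotp y z).
Qed.

Lemma dotpZl (a : R[i]) x y : dotp (a *: x) y = a * dotp x y.
Proof.
have := dotp_linearl y a x 0; rewrite addr0 => ->.
suff -> : dotp (0 : H) y = 0 by rewrite addr0.
have := dotp_linearl y 1 0 0; rewrite scaler0 addr0 mul1r => /eqP.
by rewrite -subr_eq0 opprD addNKr oppr_eq0 => /eqP.
Qed.

Lemma rdotZl t x y : rdot (t%:C *: x) y = t * rdot x y.
Proof.
by rewrite /rdot dotpZl; case: (dotp x y) => a b /=; rewrite mul0r subr0.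
Qed.

Lemma rdotNl x y : rdot (- x) y = - rdot x y.
Proof.
by rewrite -scaleN1r (_ : -1 = (-1)%:C) ?rdotZl ?mulN1r// rmorphN1.
Qed.

Lemma rdotDr x y z : rdot x (y + z) = rdot x y + rdot x z.
Proof. by rewrite rdotC rdotDl !(rdotC x). Qed.

Lemma rdotZr t x y : rdot x (t%:C *: y) = t * rdot x y.
Proof. by rewrite rdotC rdotZl rdotC. Qed.

Lemma rdotNr x y : rdot x (- y) = - rdot x y.
Proof. by rewrite rdotC rdotNl rdotC. Qed.

Definition rdotE := (rdotDl, rdotDr, rdotNl, rdotNr, rdotZl, rdotZr).

Lemma rdotxx x : rdot x x = hnorm x ^+ 2.
Proof. by rewrite /rdot dotp_normE normE -rmorphXn. Qed.

Lemma hnorm_eq0 x : hnorm x = 0 -> x = 0.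
Proof. by move=> x0; apply/eqP; rewrite -normr_eq0 normE x0. Qed.

Lemma rdot_eq0 x : rdot x x = 0 -> x = 0.
Proof. by rewrite rdotxx => /eqP; rewrite sqrf_eq0 => /eqP /hnorm_eq0. Qed.

Lemma rdot0l y : rdot 0 y = 0.
Proof. by rewrite -(subrr y) rdotDl rdotNl subrr. Qed.

(** Multiplying by the imaginary unit recovers the imaginary part of the
    complex inner product from its real part. *)
Lemma rdot_im x y : rdot ('i%C *: x) y = - complex.Im (dotp x y).
Proof.
rewrite /rdot dotpZl.
by case: (dotp x y) => a b /=; rewrite mul0r mul1r sub0r.
Qed.

Lemma rdot_im_swap x y : rdot ('i%C *: x) y = - rdot x ('i%C *: y).
Proof.
by rewrite rdot_im [in RHS]rdotC rdot_im dotp_conjC; case: (dotp y x).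
Qed.

(** Complex identities can thus be checked on real inner products alone. *)
Lemma dotp_ext x y x' y' : rdot x y = rdot x' y' ->
  rdot ('i%C *: x) y = rdot ('i%C *: x') y' -> dotp x y = dotp x' y'.
Proof.
rewrite !rdot_im => h1 /oppr_inj h2; apply/eqP.
by rewrite eq_complex; apply/andP; split; apply/eqP.
Qed.

Lemma discriminant_le (a b k : R) : 0 <= b ->
  (forall s, 0 <= a + 2 * s * k + s ^+ 2 * b) -> k ^+ 2 <= a * b.
Proof.
rewrite le_eqVlt => /predU1P[<- pos|b0 pos].
- rewrite mulr0; have [->|k0] := eqVneq k 0; first by rewrite expr0n.
  have := pos (- (a + 1) / (2 * k)).
  have -> : a + 2 * (- (a + 1) / (2 * k)) * k
            + (- (a + 1) / (2 * k)) ^+ 2 * 0 = - 1 by field.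
  lra.
- have := pos (- k / b).
  have -> : a + 2 * (- k / b) * k + (- k / b) ^+ 2 * b = a - k ^+ 2 / b.
    by field; lra.
  by rewrite subr_ge0 ler_pdivrMr.
Qed.


Lemma rdot_phase x y : exists2 u : R[i], `|u| = 1 &
  rdot (u *: x) y = complex.Re `|dotp x y|.
Proof.
have [z0|z0] := eqVneq (dotp x y) 0.
  by exists 1; rewrite ?normr1// /rdot dotpZl z0 mulr0 normr0.
exists (`|dotp x y| / dotp x y).
  by rewrite normrM normfV normr_id divff// normr_eq0.
by rewrite /rdot dotpZl divfK.
Qed.

Lemma linear_scale (T : H -> H) (hT : linear T) (a : R[i]) x :
  T (a *: x) = a *: T x.
Proof.
have T0 : T 0 = 0.
  have := hT 1 0 0; rewrite !scale1r addr0 => /eqP.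
  by rewrite -subr_eq0 opprD addNKr oppr_eq0 => /eqP.
by have := hT a x 0; rewrite T0 !addr0.
Qed.

Lemma linear_add (T : H -> H) (hT : linear T) x y : T (x + y) = T x + T y.
Proof. by have := hT 1 x y; rewrite !scale1r. Qed.

Lemma linear_opp (T : H -> H) (hT : linear T) x : T (- x) = - T x.
Proof. by rewrite -scaleN1r linear_scale// scaleN1r. Qed.

Lemma linear_sub (T : H -> H) (hT : linear T) x y : T (x - y) = T x - T y.
Proof. by rewrite linear_add// linear_opp. Qed.

Lemma linear_comp (S T : H -> H) : linear S -> linear T -> linear (S \o T).
Proof. by move=> hS hT a x y /=; rewrite hT hS. Qed.

(** Stated for the real inner product: the first clause is self-adjointness,
    which over the complex numbers already follows from [positive_op]
    ([positive_psd]). *)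
Definition psd (P : H -> H) :=
  (forall x y, rdot (P x) y = rdot x (P y)) /\ forall x, 0 <= rdot (P x) x.

(** Over the complex numbers a real quadratic form is Hermitian, by
    polarization along [x + y] and [i x + y]. *)
Lemma positive_psd P : linear P -> positive_op P -> psd P.
Proof.
move=> lP pP; split=> [x y|x]; last first.
  by have := pP x; rewrite lecE => /andP[].
have im0 x' : rdot (P x') ('i%C *: x') = 0.
  rewrite rdotC rdot_im dotp_conjC.
  by have := pP x'; rewrite lecE; case: (dotp _ _) => a b /= /andP[/eqP -> _];
    rewrite !oppr0.
have h u v : rdot (P u) ('i%C *: v) + rdot (P v) ('i%C *: u) = 0.
  have := im0 (u + v); rewrite linear_add// scalerDr !rdotE.
  by rewrite !im0 add0r addr0.
have := h x ('i%C *: y).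
rewrite (linear_scale lP) rdot_im_swap.
rewrite !scalerA -expr2 sqr_i !scaleN1r !rdotNr (rdotC x (P y)) => e.
by apply/eqP; rewrite -subr_eq0 -oppr_eq0; apply/eqP; rewrite -[RHS]e; ring.
Qed.

Lemma psd_positive P : linear P -> psd P -> positive_op P.
Proof.
move=> lP [sP pP] x; rewrite lecE /=; apply/andP; split; last exact: pP.
have := sP x ('i%C *: x).
rewrite (linear_scale lP) [RHS]rdotC => e1.
have e2 := rdot_im_swap (P x) x; have := rdot_im (P x) x.
by move=> e3; apply/eqP; lra.
Qed.

Lemma psd_cauchy_schwarz P x y : linear P -> psd P ->
  rdot (P x) y ^+ 2 <= rdot (P x) x * rdot (P y) y.
Proof.
move=> lP [sP pP]; apply: discriminant_le => // s.
have := pP (x + s%:C *: y); rewrite linear_add// linear_scale// !rdotE.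
rewrite (sP y x) (rdotC y); nra.
Qed.

(** Cauchy-Schwarz for the form of [P], applied to [x] and [P x]. *)
Lemma psd_ker P x : linear P -> psd P -> rdot (P x) x = 0 -> P x = 0.
Proof.
move=> lP pP h; apply: rdot_eq0; apply/eqP.
rewrite -sqrf_eq0 eq_le sqr_ge0 andbT.
by have := psd_cauchy_schwarz x (P x) lP pP; rewrite h mul0r.
Qed.

Lemma cauchy_schwarz x y : rdot x y <= hnorm x * hnorm y.
Proof.
have lid : linear (@id H) by [].
have pid : psd (@id H).
  by split=> // z; rewrite rdotxx sqr_ge0.
have := psd_cauchy_schwarz x y lid pid; rewrite /= !rdotxx -exprMn.
move=> h; apply: le_trans (ler_norm _) _.
by rewrite -(@ler_pXn2r _ 2)// ?nnegrE ?mulr_ge0 ?hnorm_ge0// real_normK// num_real.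
Qed.

End real_structure.

(** * Limits, Riesz representation and adjoints *)

Section completeness.
Set Implicit Arguments.
Unset Strict Implicit.
Unset Printing Implicit Defensive.
Local Open Scope complex_scope.
Context {R : realType} {H : hilbertType R}.
Implicit Types (x y z : H) (t : R).

Lemma le_of_sqr (a b : R) : 0 <= b -> a ^+ 2 <= b ^+ 2 -> a <= b.
Proof. by rewrite !expr2; nra. Qed.

Lemma harmonic_small (k e : R) : 0 < e ->
  exists N, forall n, (N <= n)%N -> k * harmonic n <= e.
Proof.
move=> e0.
have : k * harmonic n @[n --> \oo] --> (0 : R).
  by rewrite -[X in _ --> X](mulr0 k); apply: cvgMr; exact: cvg_harmonic.
move=> /cvgrPdist_le /(_ e e0)[N _ hN]; exists N => n /hN /=.
by rewrite sub0r normrN => /(le_trans (ler_norm _)).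
Qed.

(** The only way limits are used below: an inequality that holds up to
    [k / (n + 1)] for all [n] is exact. *)
Lemma le_harmonic (a b k : R) :
  (forall n, a <= b + k * harmonic n) -> a <= b.
Proof.
move=> h; apply/ler_addgt0Pr => e e0.
have [N hN] := harmonic_small k e0.
by apply: le_trans (h N) _; rewrite lerD2l hN.
Qed.

Lemma harmonic_nonincr n m : (n <= m)%N -> harmonic m <= harmonic n :> R.
Proof. by move=> nm; rewrite /harmonic /= lef_pV2 ?posrE ?ltr0n// ler_nat ltnS. Qed.

Lemma cauchy_harmonic (u : nat -> H) (k : R) :
  (forall n m, (n <= m)%N -> hnorm (u m - u n) <= k * harmonic n) ->
  exists p, forall n, hnorm (u n - p) <= k * harmonic n.
Proof.
move=> hu.
have cu : cvgn u.
  apply: cauchy_cvg; apply: cauchy_exP => e e0.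
  have [eE e0'] : e = (complex.Re e)%:C /\ 0 < complex.Re e.
    by case: e e0 => a b; rewrite ltcE /= => /andP[/eqP -> ?].
  have e2 : 0 < complex.Re e / 2 by rewrite divr_gt0.
  have [N hN] := harmonic_small k e2.
  exists (u N); exists N => // m /= Nm.
  rewrite -ball_normE /ball_ /= distrC normE [e]eE ltcR.
  by apply: le_lt_trans (hu _ _ Nm) _; apply: le_lt_trans (hN _ (leqnn N)) _; lra.
set p : H := lim (u @ \oo) in cu.
exists p => n; apply/ler_addgt0Pr => e e0.
have e0c : 0 < e%:C :> R[i] by rewrite ltcR.
have /cvgrPdist_le /(_ _ e0c) [N _ hN] := cu.
have := hN (maxn N n) (leq_maxl _ _) => /=.
rewrite distrC normE lecR => h.
have := hu n (maxn N n) (leq_maxr _ _); rewrite hdistC => h'.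
have := hnormD (u n - u (maxn N n)) (u (maxn N n) - p).
by rewrite addrA subrK => /le_trans; apply; exact: lerD.
Qed.

(** Riesz representation and orthogonal projection at once: [g] is
    represented on [V] by the limit of a sequence in [V] minimizing
    [|v|^2 - 2 g v].  The parallelogram law makes the sequence Cauchy and the
    first variation identifies the limit. *)
Lemma riesz_on (V : set H) (g : H -> R) (M : R) :
  V !=set0 -> (forall t x y, V x -> V y -> V (t%:C *: x + y)) ->
  (forall t x y, g (t%:C *: x + y) = t * g x + g y) ->
  (forall x, g x <= M * hnorm x) ->
  exists p (u : nat -> H), [/\ forall n, V (u n),
    forall n, hnorm (u n - p) <= 2 * harmonic n &
    forall v, V v -> rdot v p = g v].
Proof.
move=> [v0 Vv0] VD gD gM.
have V0 : V 0.
  by have := VD (-1) _ _ Vv0 Vv0; rewrite rmorphN1 scaleN1r addNr.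
have g0 : g 0 = 0.
  by have := gD 1 0 0; rewrite mul1r scaler0 addr0 => h; lra.
have VZ t x : V x -> V (t%:C *: x).
  by move=> Vx; have := VD t _ _ Vx V0; rewrite addr0.
have gZ t x : g (t%:C *: x) = t * g x.
  by have := gD t x 0; rewrite g0 !addr0.
pose J v := hnorm v ^+ 2 - 2 * g v.
have Jlb : lbound (J @` V) (- M ^+ 2).
  by move=> _ [v _ <-]; rewrite /J; have := gM v;
    have := sqr_ge0 (hnorm v - M); rewrite sqrrB -mulr_natr; lra.
have JV : has_inf (J @` V).
  by split; [exists (J 0), 0 | exists (- M ^+ 2)].
set m := inf (J @` V).
have mJ v : V v -> m <= J v.
  by move=> Vv; apply: ge_inf; [exact: JV.2 | exists v].
have /choice[u uP] n : exists v, V v /\ J v <= m + harmonic n ^+ 2.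
  have := @harmonic_gt0 R n => dn0.
  have [_ [v Vv <-] /ltW h] := inf_adherent (exprn_gt0 2 dn0) JV.
  by exists v.
(* First variation: [J (u n + s v) >= m] for all real [s]. *)
have var n v : V v ->
    (rdot v (u n) - g v) ^+ 2 <= harmonic n ^+ 2 * hnorm v ^+ 2.
  move=> Vv; apply: discriminant_le; first exact: sqr_ge0.
  move=> s; have [Vu Ju] := uP n.
  have := mJ _ (VD s _ _ Vv Vu); move: Ju; rewrite /J gD -!rdotxx !rdotE.
  by rewrite (rdotC (u n) v); lra.
(* Parallelogram law, from [J ((u n + u k) / 2) >= m]. *)
have cau n k : (n <= k)%N -> hnorm (u k - u n) <= 2 * harmonic n.
  move=> nk; have [Vn Jn] := uP n; have [Vk Jk] := uP k.
  have := harmonic_nonincr nk; have := @harmonic_gt0 R n.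
  have := @harmonic_gt0 R k => d0 d1 d2.
  have dd : harmonic k ^+ 2 <= harmonic n ^+ 2 :> R by rewrite !expr2; nra.
  apply: le_of_sqr; first by rewrite mulr_ge0// ltW.
  have := mJ _ (VD 2^-1 _ _ Vk (VZ 2^-1 _ Vn)).
  rewrite exprMn; move: Jn Jk; rewrite /J gD gZ -!rdotxx !rdotE.
  rewrite (rdotC (u n) (u k)); lra.
have [p hp] := cauchy_harmonic cau.
exists p, u; split=> [n|//|v Vv]; first by case: (uP n).
suff : `|rdot v p - g v| <= 0 by rewrite normr_le0 subr_eq0 => /eqP.
apply: (@le_harmonic _ _ (3 * hnorm v)) => n; rewrite add0r.
have h1 : `|rdot v (u n) - g v| <= harmonic n * hnorm v.
  apply: le_of_sqr; first by rewrite mulr_ge0 ?hnorm_ge0 ?harmonic_ge0.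
  by rewrite exprMn real_normK ?num_real// var.
have h2 := cauchy_schwarz v (u n - p); have h3 := cauchy_schwarz (- v) (u n - p).
move: h2 h3 (hp n) (hnorm_ge0 v) h1; rewrite hnormN !rdotE.
rewrite !ler_norml => ? ? ? ? /andP[]; nra.
Qed.

Lemma boundedP (T : H -> H) : bounded_op T ->
  exists2 M : R, 0 < M & forall x, hnorm (T x) <= M * hnorm x.
Proof.
move=> [_ [M hM]]; exists (`|M| + 1); first by rewrite ltr_wpDl.
move=> x; have := hM x; rewrite !normE -rmorphM lecR => /le_trans -> //.
by rewrite ler_wpM2r ?hnorm_ge0// (le_trans (ler_norm M))// lerDl.
Qed.

Lemma bounded_opI (T : H -> H) (M : R) : linear T ->
  (forall x, hnorm (T x) <= M * hnorm x) -> bounded_op T.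
Proof.
by move=> lT hM; split=> //; exists M => x; rewrite !normE -rmorphM lecR.
Qed.

Lemma dotp_injr x y : (forall z, rdot z x = rdot z y) -> x = y.
Proof.
move=> h; apply/eqP; rewrite -subr_eq0; apply/eqP/rdot_eq0.
by rewrite [LHS]rdotDr rdotNr h subrr.
Qed.

(** Riesz representation of [x |-> Re <T x, y>]; the complex identity follows
    because [T] commutes with the imaginary unit. *)
Lemma adjoint_exists (T : H -> H) : bounded_op T ->
  exists S, bounded_op S /\ is_adjoint T S.
Proof.
move=> bT; have lT := bT.1; have [M M0 hM] := boundedP bT.
have /choice[S hS] y : exists p, forall x, rdot x p = rdot (T x) y.
  have [||||p [u [_ _ h]]] := @riesz_on setT (fun x => rdot (T x) y) (M * hnorm y).
  - by exists 0.
  - by [].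
  - by move=> t x x'; rewrite lT rdotDl rdotZl.
  - move=> x; apply: le_trans (cauchy_schwarz _ _) _.
    by rewrite mulrAC ler_wpM2r ?hnorm_ge0.
  - by exists p => x; rewrite h.
have adj x y : dotp (T x) y = dotp x (S y).
  by apply: dotp_ext; rewrite hS// (linear_scale lT).
have dotp_semir (a : R[i]) (u v w : H) :
    dotp u (a *: v + w) = Num.conj a * dotp u v + dotp u w.
  by rewrite dotp_conjC dotp_linearl rmorphD rmorphM /= -!dotp_conjC.
have lS : linear S.
  move=> a y y'; apply: dotp_injr => z; rewrite /rdot -adj !dotp_semir.
  by rewrite -!adj.
exists S; split=> //; apply: (@bounded_opI _ M) => // y.
have := cauchy_schwarz (T (S y)) y; rewrite -hS rdotxx.
have := hM (S y); have := hnorm_ge0 y; have := hnorm_ge0 (S y) => s0 y0 h1 h2.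
have [->|s1] := eqVneq (hnorm (S y)) 0; first by rewrite mulr_ge0// ltW.
have sp : 0 < hnorm (S y) by rewrite lt_def s1.
rewrite -(ler_pM2l sp) -expr2; nra.
Qed.

Lemma adjointP (T : H -> H) : bounded_op T ->
  bounded_op (adjoint T) /\ is_adjoint T (adjoint T).
Proof. by move=> /adjoint_exists; exact: xgetPex. Qed.

Lemma adjointK (T : H -> H) : bounded_op T -> adjoint (adjoint T) = T.
Proof.
move=> bT; have [bS aS] := adjointP bT; have [_ aS'] := adjointP bS.
apply/funext => x; apply: dotp_injr => z.
by rewrite /rdot -aS' dotp_conjC -aS -dotp_conjC.
Qed.
End completeness.

(** * The square root iteration *)

Section square_root.
Set Implicit Arguments.
Unset Strict Implicit.
Unset Printing Implicit Defensive.
Local Open Scope complex_scope.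
Context {R : realType} {H : hilbertType R}.
Implicit Types (x y z : H) (t : R).

(** The iteration of [sqrt_iter] at the scalar [1]; it increases to [1]. *)
Fixpoint sqrt_majorant n : R :=
  if n is n'.+1 then (1 + sqrt_majorant n' ^+ 2) / 2 else 0.

Lemma sqrt_majorant_bounds n : 0 <= sqrt_majorant n <= 1.
Proof.
elim: n => [|n /andP[c0 c1]] /=; first by rewrite lexx ler01.
by apply/andP; split; rewrite expr2; nra.
Qed.

(** With [d = 1 - c_n] the recursion reads [d - d^2 / 2], which keeps
    [d <= 2 / (n + 2)]. *)
Lemma sqrt_majorant_rate n : 1 - sqrt_majorant n <= 2 * harmonic n.
Proof.
rewrite /harmonic /= ler_pdivlMr ?ltr0n//.
suff : (1 - sqrt_majorant n) * n.+2%:R <= 2.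
  have /andP[_ c1] := sqrt_majorant_bounds n.
  by rewrite -[n.+2]addn1 natrD; nra.
elim: n => [|n IH] /=; first by rewrite subr0 mul1r.
move: IH; have /andP[] := sqrt_majorant_bounds n.
rewrite -[n.+3]addn1 natrD; set c := sqrt_majorant n.
have : 0 <= n.+2%:R :> R by exact: ler0n.
move: n.+2%:R => N N0 c0 c1 h.
have : 0 <= (2 - (1 - c) * N) * (1 + c) by rewrite mulr_ge0//; lra.
have := sqr_ge0 (1 - c); lra.
Qed.

(** Fixed points [Y] satisfy [(1 - Y)^2 = 1 - X]. *)
Fixpoint sqrt_iter (X : H -> H) n : H -> H :=
  if n is n'.+1
  then fun x => (2^-1)%:C *: (X x + sqrt_iter X n' (sqrt_iter X n' x))
  else fun=> 0.

Lemma sqrt_iter_linear X n : linear X -> linear (sqrt_iter X n).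
Proof.
move=> lX; elim: n => [|n IH] a x y /=; first by rewrite scaler0 addr0.
by rewrite lX !IH addrACA -scalerDr [LHS]scalerDr !scalerA (mulrC a).
Qed.

(** The iterates are polynomials in [X], with coefficients that do not depend
    on [X]. *)
Lemma sqrt_iter_intertwine (A X X' : H -> H) : linear A ->
  (forall x, A (X x) = X' (A x)) ->
  forall n x, A (sqrt_iter X n x) = sqrt_iter X' n (A x).
Proof.
move=> lA AX; elim=> [|n IH] x /=; last first.
  by rewrite (linear_scale lA) (linear_add lA) AX !IH.
by rewrite -[in LHS](scale0r (0 : H)) (linear_scale lA) scale0r.
Qed.

Lemma eq_harmonic (x y : H) (k : R) :
  (forall n, hnorm (x - y) <= k * harmonic n) -> x = y.
Proof.
move=> h; apply/eqP; rewrite -subr_eq0; apply/eqP/hnorm_eq0/eqP.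
rewrite eq_le hnorm_ge0 andbT; apply: (@le_harmonic _ _ _ k) => n.
by rewrite add0r.
Qed.

Section iteration.
Context (X : H -> H) (lX : linear X)
  (sX : forall x y, rdot (X x) y = rdot x (X y))
  (bX : forall x, hnorm (X x) <= hnorm x).
Let Y := sqrt_iter X.
Let c := sqrt_majorant.

Lemma sqrt_iter_sym n x y : rdot (Y n x) y = rdot x (Y n y).
Proof.
elim: n x y => [|n IH] x y; first by rewrite /Y /= rdot0l rdotC rdot0l.
by rewrite /Y /= -/(Y n) !rdotE sX !IH.
Qed.

Lemma sqrt_iter_comm n m x : Y n (Y m x) = Y m (Y n x).
Proof.
apply: sqrt_iter_intertwine; first exact: sqrt_iter_linear.
by move=> z; symmetry; exact: (sqrt_iter_intertwine lX).
Qed.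

Lemma sqrt_iter_bound n x : hnorm (Y n x) <= c n * hnorm x.
Proof.
elim: n x => [|n IH] x; first by rewrite /= hnorm0 mul0r.
rewrite /Y /= -/(Y n) hnormZr ger0_norm ?invr_ge0//.
have /andP[c0 _] := sqrt_majorant_bounds n.
have := hnormD (X x) (Y n (Y n x)); have := bX x.
have := IH x; have := IH (Y n x); rewrite -/c in c0 *.
move=> h1 h2 h3 h4.
have : c n * hnorm (Y n x) <= c n * (c n * hnorm x) by rewrite ler_wpM2l.
lra.
Qed.

(** The iterates commute, so [Y_(n+1)^2 - Y_n^2] factors as
    [(Y_(n+1) + Y_n) (Y_(n+1) - Y_n)] exactly as for scalars, and each factor is
    dominated by its scalar counterpart. *)
Lemma sqrt_iter_step n x :
  hnorm (Y n.+1 x - Y n x) <= (c n.+1 - c n) * hnorm x.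
Proof.
elim: n x => [|n IH] x.
  rewrite /Y /= subr0 addr0 hnormZr ger0_norm ?invr_ge0//.
  by rewrite /c /= expr0n addr0 subr0 mul1r ler_wpM2l// invr_ge0.
have lY k : linear (Y k) by exact: sqrt_iter_linear.
have -> : Y n.+2 x - Y n.+1 x = (2^-1)%:C *:
    (Y n.+1 (Y n.+1 x - Y n x) + Y n (Y n.+1 x - Y n x)).
  rewrite -[Y n.+2 x]/(_ *: _) -[X in _ - X]/(_ *: _) -scalerBr; congr (_ *: _).
  rewrite !(linear_sub (lY _)) [Y n (Y n.+1 x)]sqrt_iter_comm subrKA.
  by rewrite opprD addrACA subrr add0r.
rewrite hnormZr ger0_norm ?invr_ge0//.
have /andP[c0 _] := sqrt_majorant_bounds n.
have /andP[c1 _] := sqrt_majorant_bounds n.+1.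
have h1 := hnormD (Y n.+1 (Y n.+1 x - Y n x)) (Y n (Y n.+1 x - Y n x)).
have h2 := sqrt_iter_bound n (Y n.+1 x - Y n x).
have h3 := sqrt_iter_bound n.+1 (Y n.+1 x - Y n x).
have h4 : (c n + c n.+1) * hnorm (Y n.+1 x - Y n x) <=
    (c n + c n.+1) * ((c n.+1 - c n) * hnorm x).
  by rewrite ler_wpM2l// addr_ge0.
have -> : c n.+2 - c n.+1 = (c n.+1 ^+ 2 - c n ^+ 2) / 2.
  have e1 : c n.+1 = (1 + c n ^+ 2) / 2 by [].
  have e2 : c n.+2 = (1 + c n.+1 ^+ 2) / 2 by [].
  lra.
lra.
Qed.

Lemma sqrt_iter_cauchy n m x : (n <= m)%N ->
  hnorm (Y m x - Y n x) <= 2 * hnorm x * harmonic n.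
Proof.
move=> nm.
have h : hnorm (Y m x - Y n x) <= (c m - c n) * hnorm x.
  rewrite -(subnK nm); elim: (m - n)%N => [|k IH].
    by rewrite add0n !subrr hnorm0 mul0r.
  rewrite addSn -[Y _ x](subrK (Y (k + n)%N x)) -addrA.
  apply: le_trans (hnormD _ _) _.
  by have := sqrt_iter_step (k + n) x; lra.
apply: le_trans h _.
have /andP[_ cm] := sqrt_majorant_bounds m; have := sqrt_majorant_rate n.
have := hnorm_ge0 x; rewrite -/c in cm *; nra.
Qed.

Lemma sqrt_iter_limit : exists Z : H -> H, [/\ linear Z,
  forall x y, rdot (Z x) y = rdot x (Z y),
  forall x, hnorm (Z x) <= hnorm x,
  forall x, Z (Z x) = 2%:C *: Z x - X x &
  forall n x, hnorm (Y n x - Z x) <= 2 * hnorm x * harmonic n].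
Proof.
have /choice[Z hZ] x : exists p,
    forall n, hnorm (Y n x - p) <= 2 * hnorm x * harmonic n.
  by apply: cauchy_harmonic => n m nm; exact: sqrt_iter_cauchy.
have lY k : linear (Y k) by exact: sqrt_iter_linear.
have bY n x : hnorm (Y n x) <= hnorm x.
  apply: le_trans (sqrt_iter_bound n x) _.
  have /andP[_ c1] := sqrt_majorant_bounds n.
  by rewrite ler_piMl// hnorm_ge0.
have bZ x : hnorm (Z x) <= hnorm x.
  apply: (@le_harmonic _ _ _ (2 * hnorm x)) => n.
  have := hnormD (Y n x) (Z x - Y n x); rewrite addrC subrK hdistC.
  by have := hZ x n; have := bY n x; lra.
exists Z; split=> //.
- move=> a x y.
  apply: (@eq_harmonic _ _ (2 * hnorm (a *: x + y)
      + complex.Re `|a| * (2 * hnorm x) + 2 * hnorm y)) => n.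
  have := hZ (a *: x + y) n; have := hZ y n; have := hZ x n.
  rewrite lY; set u := Y n x; set v := Y n y; set w := Z (_ + y) => hx hy hw.
  have -> : w - (a *: Z x + Z y) =
      (w - (a *: u + v)) + (a *: (u - Z x) + (v - Z y)).
    by rewrite scalerBr [X in _ = _ + X]addrACA -opprD addrA subrK.
  have := hnormD (w - (a *: u + v)) (a *: (u - Z x) + (v - Z y)).
  have := hnormD (a *: (u - Z x)) (v - Z y).
  have : complex.Re `|a| * hnorm (u - Z x) <=
         complex.Re `|a| * (2 * hnorm x * harmonic n).
    by rewrite ler_wpM2l// -lecR RRe_real ?normr_ge0// ger0_real.
  rewrite hnormZ (hdistC w); lra.
- move=> x y; apply/eqP; rewrite -subr_eq0 -normr_le0.
  apply: (@le_harmonic _ _ _ (4 * hnorm x * hnorm y)) => n; rewrite add0r.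
  have -> : rdot (Z x) y - rdot x (Z y) =
      rdot x (Y n y - Z y) - rdot (Y n x - Z x) y.
    by rewrite !rdotE sqrt_iter_sym; ring.
  have := hZ x n; have := hZ y n; have := hnorm_ge0 x; have := hnorm_ge0 y.
  have := cauchy_schwarz x (Y n y - Z y).
  have := cauchy_schwarz (- x) (Y n y - Z y).
  have := cauchy_schwarz (Y n x - Z x) y.
  have := cauchy_schwarz (Y n x - Z x) (- y).
  rewrite !hnormN [rdot (- x) _]rdotNl [rdot _ (- y)]rdotNr.
  set p := hnorm (Y n x - Z x); set q := hnorm (Y n y - Z y).
  move=> h1 h2 h3 h4 y0 x0 hq hp.
  have : hnorm x * q <= hnorm x * (2 * hnorm y * harmonic n).
    by rewrite ler_wpM2l.
  have : p * hnorm y <= 2 * hnorm x * harmonic n * hnorm y.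
    by rewrite ler_wpM2r.
  by rewrite ler_norml => ? ?; apply/andP; split; lra.
- move=> x.
  apply: (@eq_harmonic _ _ (8 * hnorm x)) => n.
  have dec : Z (Z x) - (2%:C *: Z x - X x) =
      (Z (Z x) - Y n (Z x)) + (Y n (Z x - Y n x) + 2%:C *: (Y n.+1 x - Z x)).
    have abel (a b d e f : H) :
        a - (f - e) = (a - b) + (b - d + (e + d - f)).
      rewrite -(addrA b) subrKA [- d + _]addrC [e + d - f]addrAC addrK.
      by rewrite opprB.
    rewrite (linear_sub (lY n)) scalerBr [Y n.+1 x]/(_ *: _) scalerA -rmorphM.
    by rewrite mulfV ?pnatr_eq0// rmorph1 scale1r; exact: abel.
  rewrite dec.
  have := hnormD (Z (Z x) - Y n (Z x))
    (Y n (Z x - Y n x) + 2%:C *: (Y n.+1 x - Z x)).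
  have := hnormD (Y n (Z x - Y n x)) (2%:C *: (Y n.+1 x - Z x)).
  have := bY n (Z x - Y n x); have := hZ (Z x) n; have := hZ x n.
  have := hZ x n.+1; rewrite hnormZr ger0_norm//.
  rewrite (hdistC (Z (Z x))) (hdistC (Z x)).
  have : hnorm x * harmonic n.+1 <= hnorm x * harmonic n.
    by rewrite ler_wpM2l ?hnorm_ge0// harmonic_nonincr.
  have : hnorm (Z x) * harmonic n <= hnorm x * harmonic n.
    by rewrite ler_wpM2r ?harmonic_ge0.
  lra.
Qed.

End iteration.
End square_root.

(** * Square roots and absolute values of operators *)

Section absolute_value.
Set Implicit Arguments.
Unset Strict Implicit.
Unset Printing Implicit Defensive.
Local Open Scope complex_scope.
Context {R : realType} {H : hilbertType R}.
Implicit Types (x y z : H) (t c : R) (A P Q S T : H -> H).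

(** Between [0] and [1] as soon as [0 <= T <= c]; a square root of
    [1 - defect T c = T / c] is what the iteration produces. *)
Definition defect T c x : H := x - (c^-1)%:C *: T x.

Definition sqrt_approx T c n x : H :=
  (Num.sqrt c)%:C *: (x - sqrt_iter (defect T c) n x).

(** The approximants depend on [T] and [c] only, which is what makes square
    roots of different operators comparable; [c] must be shared. *)
Definition approximated T c S := exists k : R,
  forall n x, hnorm (sqrt_approx T c n x - S x) <= k * hnorm x * harmonic n.

Lemma defect_linear T c : linear T -> linear (defect T c).
Proof.
move=> lT a u v; rewrite /defect lT scalerDr opprD addrACA scalerBr !scalerA.
by rewrite (mulrC a).
Qed.

(** For [X] between [0] and [1], Cauchy-Schwarz for the form of [X] at [x] and
    [X x] gives [|X x|^4 <= <X x, x> <X X x, X x> <= |x|^2 |X x|^2]. *)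
Lemma defect_contraction T c : linear T -> psd T -> 0 < c ->
  (forall x, hnorm (T x) <= c * hnorm x) ->
  forall x, hnorm (defect T c x) <= hnorm x.
Proof.
move=> lT [sT pT] c0 bT x.
have cT z : rdot (T z) z <= c * rdot z z.
  apply: le_trans (cauchy_schwarz _ _) _; rewrite rdotxx expr2 mulrA.
  by rewrite ler_wpM2r ?hnorm_ge0.
have ci : 0 < c^-1 by rewrite invr_gt0.
have cc z : c^-1 * rdot (T z) z <= rdot z z.
  by rewrite mulrC ler_pdivrMr// mulrC.
have lX := defect_linear c lT.
have pX : psd (defect T c).
  split=> [u v|u]; rewrite /defect !rdotE; first by rewrite sT.
  by have := cc u; lra.
have qX z : rdot (defect T c z) z = rdot z z - c^-1 * rdot (T z) z.
  by rewrite /defect !rdotE.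
have := psd_cauchy_schwarz x (defect T c x) lX pX.
set w := defect T c x; rewrite rdotxx => h.
have h1 : rdot w x <= hnorm x ^+ 2.
  rewrite qX -rdotxx.
  by have := mulr_ge0 (ltW ci) (pT x); lra.
have h2 : rdot (defect T c w) w <= hnorm w ^+ 2.
  by rewrite qX -rdotxx; have := mulr_ge0 (ltW ci) (pT w); lra.
have w0 := hnorm_ge0 w; have x0 := hnorm_ge0 x.
have h3 : rdot w x * rdot (defect T c w) w <= hnorm x ^+ 2 * hnorm w ^+ 2.
  by apply: ler_pM => //; [exact: pX.2 | exact: pX.2].
have [->//|wn] := eqVneq (hnorm w) 0.
have wp : 0 < hnorm w ^+ 2 by rewrite exprn_gt0// lt_def wn.
apply: le_of_sqr => //; rewrite -(ler_pM2r wp); apply: le_trans h3.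
by rewrite -expr2.
Qed.

Lemma psd_sqrt T c : linear T -> psd T -> 0 < c ->
  (forall x, hnorm (T x) <= c * hnorm x) ->
  exists S, [/\ bounded_op S, psd S, S \o S = T & approximated T c S].
Proof.
move=> lT pT c0 bT.
have lX := defect_linear c lT.
have sX x y : rdot (defect T c x) y = rdot x (defect T c y).
  by rewrite /defect !rdotE pT.1.
have [Z [lZ sZ bZ qZ hZ]] :=
  sqrt_iter_limit lX sX (defect_contraction lT pT c0 bT).
have r0 : 0 <= Num.sqrt c by exact: sqrtr_ge0.
pose S x : H := (Num.sqrt c)%:C *: (x - Z x).
have lS : linear S.
  move=> a u v; rewrite /S lZ opprD addrACA -scalerBr scalerDr !scalerA.
  by rewrite (mulrC a).
exists S; split.
- apply: (@bounded_opI _ _ _ (Num.sqrt c * 2)) => // x.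
  rewrite hnormZr ger0_norm// -mulrA ler_wpM2l//.
  by have := hnormD x (- Z x); rewrite hnormN; have := bZ x; lra.
- split=> [x y|x]; rewrite /S !rdotE; first by rewrite sZ.
  rewrite mulr_ge0// subr_ge0; apply: le_trans (cauchy_schwarz _ _) _.
  by rewrite rdotxx expr2 ler_wpM2r ?hnorm_ge0.
- apply/funext => x; rewrite /S /= (linear_scale lZ) -scalerBr scalerA.
  rewrite -rmorphM -expr2 sqr_sqrtr ?(ltW c0)//.
  rewrite (linear_sub lZ) qZ.
  have -> : x - Z x - (Z x - (2%:C *: Z x - defect T c x)) =
    (c^-1)%:C *: T x.
    have abel (a b e : H) : a - b - (b - (b + b - e)) = a - e.
      by rewrite opprB [b + b - e]addrAC addrK subrKA.
    by rewrite rmorph_nat scaler_nat mulr2n abel /defect opprB addrC subrK.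
  by rewrite scalerA -rmorphM mulfV ?gt_eqF// scale1r.
- exists (2 * Num.sqrt c) => n x.
  rewrite /sqrt_approx /S -scalerBr hnormZr ger0_norm//.
  have -> : x - sqrt_iter (defect T c) n x - (x - Z x) =
    - (sqrt_iter (defect T c) n x - Z x).
    by rewrite opprD opprK addrACA subrr add0r opprB addrC.
  by rewrite hnormN; have := ler_wpM2l r0 (hZ n x); lra.
Qed.

(** The approximants of the two square roots are built by the same recipe, so
    an intertwining relation passes to them and then to the limits. *)
Lemma approximated_intertwine A T T' c S S' : bounded_op A ->
  (forall x, A (T x) = T' (A x)) ->
  approximated T c S -> approximated T' c S' ->
  forall x, A (S x) = S' (A x).
Proof.
move=> bA AT [k hk] [k' hk'] x; have [M M0 hM] := boundedP bA; have lA := bA.1.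
apply: (@eq_harmonic _ _ _ _ (M * (k * hnorm x) + k' * hnorm (A x))) => n.
have e : A (sqrt_approx T c n x) = sqrt_approx T' c n (A x).
  rewrite /sqrt_approx (linear_scale lA) (linear_sub lA).
  rewrite (@sqrt_iter_intertwine _ _ A _ (defect T' c))// => z.
  by rewrite /defect (linear_sub lA) (linear_scale lA) AT.
have -> : A (S x) - S' (A x) = A (S x - sqrt_approx T c n x) +
    (sqrt_approx T' c n (A x) - S' (A x)).
  by rewrite (linear_sub lA) e addrA subrK.
apply: le_trans (hnormD _ _) _; rewrite mulrDl lerD// -mulrA.
by apply: le_trans (hM _) _; rewrite ler_pM2l// hdistC.
Qed.

(** With [d = (P - S) x], commutation gives [<P d, d> + <S d, d> =
    <(P^2 - S^2) x, d> = 0], so [P] and [S] both kill [d], and then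
    [|d|^2 = <x, (P - S) d> = 0]. *)
Lemma psd_sqrt_unique P S : linear P -> linear S -> psd P -> psd S ->
  (forall x, P (S x) = S (P x)) -> P \o P = S \o S -> P = S.
Proof.
move=> lP lS pP pS com sq; apply/funext => x; apply/eqP.
rewrite -subr_eq0; apply/eqP; set d := P x - S x.
have sqx z : P (P z) = S (S z) by have := congr1 (fun f => f z) sq.
have e : rdot (P d) d + rdot (S d) d = 0.
  rewrite -rdotDl {1 3}/d (linear_sub lP) (linear_sub lS) sqx com subrKA.
  by rewrite subrr rdot0l.
have p0 := pP.2 d; have s0 := pS.2 d.
have Pd : P d = 0 by apply: psd_ker => //; lra.
have Sd : S d = 0 by apply: psd_ker => //; lra.
apply: rdot_eq0; rewrite {1}/d rdotDl rdotNl pP.1 pS.1 Pd Sd.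
by rewrite rdotC rdot0l subr0.
Qed.

(** Any positive square root [P] of [T] commutes with [T = P^2], hence with the
    limit of the iteration, and is therefore equal to it. *)
Lemma sqrt_opP T c : bounded_op T -> psd T -> 0 < c ->
  (forall x, hnorm (T x) <= c * hnorm x) ->
  [/\ bounded_op (sqrt_op T), psd (sqrt_op T), sqrt_op T \o sqrt_op T = T
    & approximated T c (sqrt_op T)].
Proof.
move=> bT pT c0 hc; have lT := bT.1.
have [S [bS pS SS aS]] := psd_sqrt lT pT c0 hc.
have [bP pP PP] : [set S | [/\ bounded_op S, positive_op S & S \o S = T]]
    (sqrt_op T).
  by apply: xgetPex; exists S; split=> //; apply: psd_positive => //; exact: bS.1.
have psP := positive_psd bP.1 pP.
suff <- : S = sqrt_op T by [].
symmetry; apply: psd_sqrt_unique => //; [exact: bP.1 | exact: bS.1 | | by rewrite PP].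
apply: (approximated_intertwine bP _ aS aS) => x.
have PPx z : sqrt_op T (sqrt_op T z) = T z by exact: (congr1 (@^~ z) PP).
by rewrite -!PPx.
Qed.

Lemma adjoint_comp_psd T S : bounded_op T -> bounded_op S -> is_adjoint T S ->
  bounded_op (S \o T) /\ psd (S \o T).
Proof.
move=> bT bS aS; have ad x y : rdot (T x) y = rdot x (S y).
  by rewrite /rdot aS.
have [M M0 hM] := boundedP bT; have [N N0 hN] := boundedP bS.
split.
  apply: (@bounded_opI _ _ _ (N * M)); first exact: linear_comp bS.1 bT.1.
  move=> x /=; apply: le_trans (hN _) _.
  by rewrite -mulrA ler_pM2l.
split=> [x y|x] /=; last by rewrite rdotC -ad rdotxx sqr_ge0.
by rewrite -ad rdotC -ad rdotC.
Qed.

(** What mixed Schwarz uses: [A] and [|A|] have the same Gram form, hence the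
    same norms and kernel, and [A] intertwines [|A|] and [|A*|]. *)
Lemma abs_opP A : bounded_op A ->
  [/\ bounded_op (abs_op A) /\ psd (abs_op A),
      bounded_op (abs_op (adjoint A)) /\ psd (abs_op (adjoint A)),
      forall x, hnorm (abs_op A x) = hnorm (A x),
      forall x y, rdot (A x) (A y) = rdot (abs_op A x) (abs_op A y) &
      forall x, A (abs_op A x) = abs_op (adjoint A) (A x)].
Proof.
move=> bA; have [bB aB] := adjointP bA; have BK := adjointK bA.
have aB' : is_adjoint (adjoint A) A.
  by move=> x y; rewrite dotp_conjC -aB -dotp_conjC.
have [bT pT] := adjoint_comp_psd bA bB aB.
have [bT' pT'] := adjoint_comp_psd bB bA aB'.
have [M M0 hM] := boundedP bT; have [N N0 hN] := boundedP bT'.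
(* One bound for both [A* A] and [A A*], so that their approximants match. *)
have c0 : 0 < M + N by exact: addr_gt0.
have hc x : hnorm ((adjoint A \o A) x) <= (M + N) * hnorm x.
  by have := hM x; have := mulr_ge0 (ltW N0) (hnorm_ge0 x); lra.
have hc' x : hnorm ((A \o adjoint A) x) <= (M + N) * hnorm x.
  by have := hN x; have := mulr_ge0 (ltW M0) (hnorm_ge0 x); lra.
have [bP pP PP aP] := sqrt_opP bT pT c0 hc.
have [bQ pQ QQ aQ] := sqrt_opP bT' pT' c0 hc'.
have eQ : abs_op (adjoint A) = sqrt_op (A \o adjoint A) by rewrite /abs_op BK.
have nA x y : rdot (A x) (A y) = rdot (abs_op A x) (abs_op A y).
  rewrite pP.1 -[sqrt_op _ (abs_op A y)]/((sqrt_op _ \o sqrt_op _) y) PP /=.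
  by rewrite /rdot aB.
rewrite eQ; split=> // x; last exact: approximated_intertwine aP aQ x.
apply/eqP; rewrite -(@eqrXn2 _ 2) ?hnorm_ge0//.
by rewrite -!rdotxx nA.
Qed.

(** The mixed Schwarz inequality [|<Ax,y>|^2 <= <|A|x,x> <|A*|y,y>] in its
    linearized form.  For [x = |A| z] the intertwining relation turns the
    difference of the two sides into [<|A*|(Az - y), Az - y>].  Such [x] are
    dense modulo [ker |A|], which is also [ker A]. *)
Lemma mixed_schwarz A : bounded_op A -> forall x y,
  2 * rdot (A x) y <= rdot (abs_op A x) x + rdot (abs_op (adjoint A) y) y.
Proof.
move=> bA x y.
have [[bP pP] [bQ pQ] nP nA int] := abs_opP bA.
move: bP pP bQ pQ nP nA int.
set P := abs_op A; set Q := abs_op (adjoint A) => bP pP bQ pQ nP nA int.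
have lA := bA.1; have lP := bP.1; have lQ := bQ.1.
have onP z : 2 * rdot (A (P z)) y <= rdot (P (P z)) (P z) + rdot (Q y) y.
  have := pQ.2 (A z - y); rewrite (linear_sub lQ) !rdotE -int (pQ.1 y (A z)) -int.
  have -> : rdot (A (P z)) (A z) = rdot (P (P z)) (P z).
    exact: nA.
  rewrite (rdotC y (A (P z))); lra.
(* [p] is the orthogonal projection of [x] on the closed range of [P]. *)
have [||||p [u [Vu hu hp]]] :=
  @riesz_on _ _ (range P) (fun v => rdot v x) (hnorm x).
- by exists (P 0), 0.
- move=> t _ _ [a _ <-] [b _ <-]; exists (t%:C *: a + b) => //.
  by rewrite lP.
- by move=> t a b; rewrite rdotDl rdotZl.
- by move=> a; rewrite mulrC cauchy_schwarz.
have Pxp : P (x - p) = 0.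
  have VPP : range P (P (P (x - p))) by exists (P (x - p)).
  by apply: rdot_eq0; rewrite -pP.1 rdotDr rdotNr (hp _ VPP) subrr.
have [M M0 hM] := boundedP bP.
(* Both sides move by at most a multiple of [|P (x - u n)|] when [x] is
   replaced by [u n], because [|A d| = |P d|]. *)
pose k := 2 * M * hnorm y + M * hnorm x + M * (hnorm p + 2).
apply: (@le_harmonic _ _ _ (2 * k)) => n.
have [z _ uz] := Vu n; have := onP z; rewrite uz => h.
have hd : hnorm (P (x - u n)) <= M * (2 * harmonic n).
  have -> : P (x - u n) = P (x - p) - P (u n - p).
    by rewrite -(linear_sub lP) opprB subrKA.
  rewrite Pxp sub0r hnormN; apply: le_trans (hM _) _.
  by rewrite ler_pM2l.
have hA := nP (x - u n).
have eA : rdot (A x) y = rdot (A (u n)) y + rdot (A (x - u n)) y.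
  by rewrite (linear_sub lA) rdotDl rdotNl; ring.
have eP : rdot (P x) x = rdot (P (u n)) (u n) + rdot (P (x - u n)) x
    + rdot (P (x - u n)) (u n).
  by rewrite (linear_sub lP) !rdotE (pP.1 x (u n)) (rdotC x); ring.
have hun : hnorm (u n) <= hnorm p + 2.
  have := hnormD p (u n - p); rewrite addrC subrK => /le_trans -> //.
  rewrite lerD2l; apply: le_trans (hu n) _.
  by rewrite ler_piMr// /harmonic /= invf_le1 ?ltr0n// ler1n.
have c1 := cauchy_schwarz (A (x - u n)) y.
have c2 := cauchy_schwarz (- P (x - u n)) x.
have c3 := cauchy_schwarz (- P (x - u n)) (u n).
rewrite eA eP; move: c1 c2 c3; rewrite -hA !hnormN ![rdot (- _) _]rdotNl.
set e := hnorm (P (x - u n)) in hd *.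
have d0 := @harmonic_ge0 R n.
have e1 : e * hnorm y <= M * (2 * harmonic n) * hnorm y.
  by rewrite ler_wpM2r ?hnorm_ge0.
have e2 : e * hnorm x <= M * (2 * harmonic n) * hnorm x.
  by rewrite ler_wpM2r ?hnorm_ge0.
have e3 : e * hnorm (u n) <= M * (2 * harmonic n) * (hnorm p + 2).
  by apply: ler_pM; rewrite ?hnorm_ge0.
rewrite /k; lra.
Qed.

Lemma bounded_op_add S T : bounded_op S -> bounded_op T -> bounded_op (S \+ T).
Proof.
move=> bS bT; have [M _ hM] := boundedP bS; have [N _ hN] := boundedP bT.
apply: (@bounded_opI _ _ _ (M + N)) => [a x y|x] /=.
  by rewrite bS.1 bT.1 scalerDr addrACA.
by rewrite mulrDl; apply: le_trans (hnormD _ _) _; rewrite lerD.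
Qed.

Lemma hnorm_le_opnorm T x : bounded_op T -> hnorm x <= 1 ->
  hnorm (T x) <= opnorm T.
Proof.
move=> bT x1; have [M M0 hM] := boundedP bT.
apply: ub_le_sup; last first.
  by exists x => //=; rewrite normE lecR.
exists M => _ [z /= z1 <-]; move: z1; rewrite normE lecR => z1.
by apply: le_trans (hM z) _; rewrite -{2}(mulr1 M) ler_pM2l.
Qed.

Lemma opnorm_ge0 T : bounded_op T -> 0 <= opnorm T.
Proof.
move=> bT; apply: le_trans (hnorm_ge0 (T 0)) _.
by apply: hnorm_le_opnorm => //; rewrite hnorm0.
Qed.

(** The supremum defining [numerical_radius] is over the empty set when
    [H = 0], hence the hypothesis [0 <= b]. *)
Lemma numerical_radius_le A (b : R) : 0 <= b ->
  (forall x, hnorm x = 1 -> complex.Re `|dotp (A x) x| <= b) ->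
  numerical_radius A <= b.
Proof.
move=> b0 h; rewrite /numerical_radius.
set E := (X in sup X); have [->|E0] := eqVneq E set0; first by rewrite sup0.
apply: ge_sup; first exact/set0P.
by move=> _ [x /= x1 <-]; apply: h; rewrite /hnorm x1.
Qed.

(** Replacing [x] by [u x], with [u] the phase of [<Ax,x>], turns the bound on
    a real part into one on the modulus; [<|A|x,x>] does not change. *)
Lemma numerical_range_le_abs A x : bounded_op A -> hnorm x = 1 ->
  complex.Re `|dotp (A x) x| <= 2^-1 * opnorm (abs_op A \+ abs_op (adjoint A)).
Proof.
move=> bA x1; have [[bP pP] [bQ pQ] _ _ _] := abs_opP bA.
have [u u1 <-] := rdot_phase (A x) x.
rewrite -(linear_scale bA.1).
have := mixed_schwarz bA (u *: x) x.
have -> : rdot (abs_op A (u *: x)) (u *: x) = rdot (abs_op A x) x.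
  rewrite (linear_scale bP.1) /rdot dotpZl dotp_conjC dotpZl rmorphM /= mulrA.
  by rewrite -dotp_conjC -normCK u1 expr1n mul1r.
have bPQ := bounded_op_add bP bQ.
have x1' : hnorm x <= 1 by rewrite x1.
have := hnorm_le_opnorm bPQ x1'.
have := cauchy_schwarz ((abs_op A \+ abs_op (adjoint A)) x) x.
rewrite x1 mulr1 /= rdotDl; lra.
Qed.

Lemma numerical_range_le_opnorm A x : bounded_op A -> hnorm x = 1 ->
  complex.Re `|dotp (A x) x| <= opnorm A.
Proof.
move=> bA x1; have [u u1 <-] := rdot_phase (A x) x.
apply: le_trans (cauchy_schwarz _ _) _.
rewrite hnormZ u1 mul1r x1 mulr1.
by apply: hnorm_le_opnorm => //; rewrite x1.
Qed.

End absolute_value.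

Theorem theorem3p2 (R : realType) (H : hilbertType R) (A : H -> H)
    (hA : bounded_op A) (lambda : R) (hlambda : 0 <= lambda <= 1) :
  let r := Num.min lambda (1 - lambda) in
  numerical_radius A <=
    (1 - 2 * r) / 2 * opnorm (abs_op A \+ abs_op (adjoint A))
    + 2 * r * opnorm A.
Proof.
cbv zeta; set r := Num.min _ _; have [r0 r1] : 0 <= r /\ 2 * r <= 1.
  by rewrite /r; case: (leP lambda (1 - lambda)) => ?; split; lra.
have [[bP _] [bQ _] _ _ _] := abs_opP hA.
have N0 := opnorm_ge0 (bounded_op_add bP bQ); have A0 := opnorm_ge0 hA.
apply: numerical_radius_le => [|x x1].
  by rewrite addr_ge0// mulr_ge0//; lra.
have h1 := numerical_range_le_abs hA x1.
have h2 := numerical_range_le_opnorm hA x1.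
set w := complex.Re _ in h1 h2 *.
have : (1 - 2 * r) * w
    <= (1 - 2 * r) * (2^-1 * opnorm (abs_op A \+ abs_op (adjoint A))).
  by rewrite ler_wpM2l//; lra.
have : 2 * r * w <= 2 * r * opnorm A by rewrite ler_wpM2l// mulr_ge0.
lra.
Qed.
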